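(* For every countable ordinal $\alpha$ with $1<\alpha<\omega_1$, $(\mathrm{fin}^{\otimes\alpha},\subseteq)\equiv_T(\omega^\omega,\le)$, where $\le$ on $\omega^\omega$ is everywhere domination.
   Context: $\mathrm{fin}=[\omega]^{<\omega}$. Sets $\omega^\alpha$ and ideals $\mathrm{fin}^{\otimes\alpha}$ on them are defined recursively: $\omega^1=\omega$, $\mathrm{fin}^{\otimes1}=\mathrm{fin}$; $\omega^{\alpha+1}=\omega\times\omega^\alpha$ and $A\in\mathrm{fin}^{\otimes\alpha+1}$ iff for all but finitely many $n$, $(A)_n=\{y:(n,y)\in A\}\in\mathrm{fin}^{\otimes\alpha}$; for limit $\alpha$, a fixed increasing sequence $\langle\alpha_n\rangle$ of nonzero ordinals with supremum $\alpha$ is used, $\omega^\alpha=\biguplus_n\{n\}\times\omega^{\alpha_n}$, and $A\in\mathrm{fin}^{\otimes\alpha}$ iff for all but finitely many $n$, $(A)_n\in\mathrm{fin}^{\otimes\alpha_n}$. $\omega^\omega$ (the set of functions $\omega\to\omega$) has $f\le g$ iff $f(n)\le g(n)$ for all $n$. $P\le_TQ$ means there is $f:Q\to P$ mapping cofinal subsets to cofinal subsets; $\equiv_T$ is two-way $\le_T$. *)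

(* Defs.v *)
From HB Require Import structures.
From mathcomp Require Import all_boot all_order.
From mathcomp Require Import boolp classical_sets functions cardinality.

Set Implicit Arguments.
Unset Strict Implicit.
Unset Printing Implicit Defensive.

Import Order.TTheory.
Local Open Scope classical_set_scope.
Local Open Scope order_scope.

(** * Tukey reducibility *)

Definition cofinal (P : Type) (le : P -> P -> Prop) (C : set P) : Prop :=
  forall p, exists2 c, C c & le p c.

Definition tukey_le (P Q : Type)
    (leP : P -> P -> Prop) (leQ : Q -> Q -> Prop) : Prop :=
  exists f : Q -> P, forall C : set Q, cofinal leQ C -> cofinal leP (f @` C).

Definition tukey_equiv (P Q : Type)
    (leP : P -> P -> Prop) (leQ : Q -> Q -> Prop) : Prop :=
  tukey_le leP leQ /\ tukey_le leQ leP.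

Definition dominated (f g : nat -> nat) : Prop := forall n, (f n <= g n)%N.

(** * Countable ordinals

   A linear order satisfying [is_omega1] has order type omega_1; an element [a]
   stands for the countable ordinal that is the order type of [[set b | b < a]]. *)

Record is_omega1 (d : Order.disp_t) (W : orderType d) : Prop := IsOmega1 {
  omega1_wf : well_founded (fun a b : W => a < b);
  omega1_segment : forall a : W, countable [set b : W | b < a];
  omega1_uncountable : ~ countable [set: W]
}.

Section Ordinals.
Variables (d : Order.disp_t) (W : orderType d).
Implicit Types a b c : W.

Definition is_zero a : Prop := forall b, a <= b.

(** [is_succ a b] : [b = a + 1]. *)
Definition is_succ a b : Prop := a < b /\ forall c, a < c -> b <= c.

Definition is_one a : Prop := exists2 z, is_zero z & is_succ z a.

Definition is_limit a : Prop := ~ is_zero a /\ ~ exists b, is_succ b a.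

Definition is_fundamental a (s : nat -> W) : Prop :=
  [/\ forall n, ~ is_zero (s n),
      {homo s : m n / (m < n)%N >-> m < n}
    & supremums (range s) a].

(** A choice of a fundamental sequence for every limit; the values of [fseq] at
   other ordinals are irrelevant. *)
Record fundamental_system := FundamentalSystem {
  fseq :> W -> nat -> W;
  fseqP : forall a, is_limit a -> is_fundamental a (fseq a)
}.

Lemma fundamental_lt a (s : nat -> W) : is_fundamental a s -> forall n, s n < a.
Proof.
move=> [_ s_incr [s_ub _]] n.
by apply: (lt_le_trans (s_incr n n.+1 (ltnSn n))); apply: s_ub; exists n.+1.
Qed.

End Ordinals.

(** * The sets omega^a with the ideals fin^{(x) a} *)

Record setfam := SetFam { carrier : Type; members : set (set carrier) }.

Definition members_le (X : setfam) (A B : {A : set (carrier X) | members A}) :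
  Prop := sval A `<=` sval B.

Definition fin_setfam : setfam := @SetFam nat (fun A => finite_set A).

Definition succ_setfam (X : setfam) : setfam :=
  @SetFam (nat * carrier X)%type
    (fun A => finite_set [set n | ~ members [set y | A (n, y)]]).

Definition limit_setfam (X : nat -> setfam) : setfam :=
  @SetFam {n : nat & carrier (X n)}
    (fun A => finite_set [set n | ~ members [set y | A (existT _ n y)]]).

Section FinPower.
Variables (d : Order.disp_t) (W : orderType d).
Variables (W_omega1 : is_omega1 W) (s : fundamental_system W).

Definition fin_power_step (a : W) (rec : forall b : W, b < a -> setfam) :
    setfam :=
  if pselect (is_one a) is left _ then fin_setfam else
  match pselect (exists b, is_succ b a) with
  | left succ_a =>
      let: exist b ba := cid succ_a in succ_setfam (rec b (proj1 ba))
  | right _ =>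
      match pselect (is_limit a) with
      | left lim_a =>
          limit_setfam (fun n => rec (s a n) (fundamental_lt (fseqP s lim_a) n))
      | right _ => fin_setfam (* junk value at 0 *)
      end
  end.

(** [carrier (fin_power a)] is omega^a and [members (fin_power a)] is
   fin^{(x) a}, for [a] nonzero; see the equations below. *)
Definition fin_power : W -> setfam :=
  Fix (omega1_wf W_omega1) (fun _ => setfam) fin_power_step.

Lemma fin_powerE a : fin_power a = fin_power_step (fun b (_ : b < a) => fin_power b).
Proof.
apply: Fix_eq => {}a f g fg; congr fin_power_step.
by apply/functional_extensionality_dep => b; apply/functional_extensionality_dep.
Qed.

Lemma is_succ_inj (b c a : W) : is_succ b a -> is_succ c a -> b = c.
Proof.
move=> [ba bS] [ca cS]; apply/eqP; case: ltgtP => // [bc|cb].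
  by move: (bS _ bc); rewrite leNgt ca.
by move: (cS _ cb); rewrite leNgt ba.
Qed.

Lemma fin_power_one a : is_one a -> fin_power a = fin_setfam.
Proof. by move=> one_a; rewrite fin_powerE /fin_power_step; case: pselect. Qed.

Lemma fin_power_succ b a : ~ is_zero b -> is_succ b a ->
  fin_power a = succ_setfam (fin_power b).
Proof.
move=> b0 ba; rewrite fin_powerE /fin_power_step.
case: pselect => [[z z0 za]|_]; first by rewrite (is_succ_inj ba za) in b0.
case: pselect => [|[]]; last by exists b.
by move=> succ_a; case: cid => c ca; rewrite (is_succ_inj ca ba).
Qed.

Lemma fin_power_limit a : is_limit a ->
  fin_power a = limit_setfam (fun n => fin_power (s a n)).
Proof.
move=> lim_a; rewrite fin_powerE /fin_power_step.
have [_ Nsucc] := lim_a.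
case: pselect => [[z _ za]|_]; first by case: Nsucc; exists z.
by case: pselect => // _; case: pselect.
Qed.

End FinPower.

(* Main.v *)
(** P <=_T Q follows from maps g : P -> Q and f : Q -> P such that g p <= q
    implies p <= f q.  Let X be the ideal of the sets almost all of whose
    sections lie in X_n.  If every X_n lies below omega^omega, a set A in X is
    coded by a bound N for its exceptional sections, together with the codes of
    the sections (A)_n for n >= N; so X lies below omega^omega.  If every X_n
    lies above omega, h in omega^omega is sent to the set whose n-th section is
    the image in X_n of max (h 0, ..., h n).  A set A in X containing it yields
    a bound for h (max (n, N)) and all earlier values, h n among them, where N
    depends on A only: domination is thus everywhere, not just eventual. *)

Require Import Defs.
From mathcomp Require Import all_boot all_order.
From mathcomp Require Import boolp classical_sets functions cardinality.

Local Open Scope classical_set_scope.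

(** Choice makes the bound a function of the set, for use in the maps below; its value on infinite
    sets is arbitrary. *)
Lemma finite_set_nat_bound :
  exists N : set nat -> nat, forall A, finite_set A -> forall n, A n -> n < N A.
Proof.
suff: forall A : set nat, exists N, finite_set A -> forall n, A n -> n < N
  by case/choice => N NP; exists N.
move=> A.
have [/finite_seqP[s ->]|] := pselect (finite_set A); last by exists 0.
exists (\max_(i <- s) i).+1 => _ n /= ns.
by rewrite ltnS; exact: (leq_bigmax_seq (F := id)).
Qed.

(** Both maps are total on sets, but constrained on members only. *)
Definition ideal_below (X : setfam) {Q : Type} (leQ : Q -> Q -> Prop) : Prop :=
  exists (g : set (carrier X) -> Q) (f : Q -> set (carrier X)),
    (forall q, members (f q)) /\
    forall A q, members A -> leQ (g A) q -> A `<=` f q.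

Definition ideal_above {Q : Type} (leQ : Q -> Q -> Prop) (X : setfam) : Prop :=
  exists (g : Q -> set (carrier X)) (f : set (carrier X) -> Q),
    (forall q, members (g q)) /\
    forall q A, members A -> g q `<=` A -> leQ q (f A).

(** Given A and a cofinal C, some c in C lies above [g A], and then [f c] contains A. *)
Lemma ideal_below_tukey_le (X : setfam) (Q : Type) (leQ : Q -> Q -> Prop) :
  ideal_below X leQ -> tukey_le (@members_le X) leQ.
Proof.
move=> [g [f [fX gf]]]; exists (fun q => exist _ (f q) (fX q)) => C Ccof [A XA].
have [c Cc gAc] := Ccof (g A).
by exists (exist _ (f c) (fX c)); [exists c | exact: gf].
Qed.

Lemma ideal_above_tukey_le (X : setfam) (Q : Type) (leQ : Q -> Q -> Prop) :
  ideal_above leQ X -> tukey_le leQ (@members_le X).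
Proof.
move=> [g [f [gX gf]]]; exists (fun A => f (sval A)) => C Ccof q.
have [[A XA] CA gqA] := Ccof (exist _ (g q) (gX q)).
by exists (f A); [exists (exist _ A XA) | exact: gf].
Qed.

(** A successor stage is a limit stage with constant sequence, up to passing between pairs and
    dependent pairs; both can thus share one argument. *)
Lemma ideal_below_succ (X : setfam) (Q : Type) (leQ : Q -> Q -> Prop) :
  ideal_below (limit_setfam (fun=> X)) leQ -> ideal_below (succ_setfam X) leQ.
Proof.
move=> [g [f [fX gf]]].
exists (fun A : set (nat * carrier X) =>
  g [set u : {_ : nat & carrier X} | A (tag u, tagged u)]).
exists (fun q => [set u : nat * carrier X | f q (existT _ u.1 u.2)]).
split => [q|A q XA gAq].
  exact: fX.
by move=> [n y] Any; apply: (gf _ q XA gAq).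
Qed.

Lemma ideal_above_succ (X : setfam) (Q : Type) (leQ : Q -> Q -> Prop) :
  ideal_above leQ (limit_setfam (fun=> X)) -> ideal_above leQ (succ_setfam X).
Proof.
move=> [g [f [gX gf]]].
exists (fun q => [set u : nat * carrier X | g q (existT _ u.1 u.2)]).
exists (fun A : set (nat * carrier X) =>
  f [set u : {_ : nat & carrier X} | A (tag u, tagged u)]).
split => [q|q A XA gqA].
  exact: gX.
by apply: gf => // -[n y] /= gny; apply: gqA.
Qed.

Lemma limit_members_eventually (X : nat -> setfam) :
  exists N : set (carrier (limit_setfam X)) -> nat,
    forall A, members A ->
    forall n, N A <= n -> members [set y | A (existT _ n y)].
Proof.
have [N NP] := finite_set_nat_bound.
exists (fun A => N [set n | ~ members [set y | A (existT _ n y)]]) => A XA n.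
by apply: contraPP => /(NP _ XA); rewrite ltnNge => /negP.
Qed.

Lemma ideal_below_limit (X : nat -> setfam) :
  (forall n, ideal_below (X n) dominated) ->
  ideal_below (limit_setfam X) dominated.
Proof.
move=> XP; have [N NP] := limit_members_eventually X.
pose g n := projT1 (cid (XP n)); pose f n := projT1 (cid (projT2 (cid (XP n)))).
have fX n h : members (f n h) by exact: (projT2 (cid (projT2 (cid (XP n))))).1.
have gf n : forall A h, members A -> dominated (g n A) h -> A `<=` f n h.
  exact: (projT2 (cid (projT2 (cid (XP n))))).2.
(* Position 0 of h is kept for the bound; the k-th value of the code of section n sits at position
   [(pickle (n, k)).+1]. *)
pose part (h : nat -> nat) (n k : nat) := h (pickle (n, k)).+1.
exists (fun A i => if i is j.+1 then
  if unpickle j is Some (n, k) then g n [set y | A (existT _ n y)] k else 0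
  else N A).
(* Sections before [h 0] may be exceptional, so they are included in full. *)
exists (fun h => [set u : {n : nat & carrier (X n)} |
  tag u < h 0 \/ f (tag u) (part h (tag u)) (tagged u)]).
split => [h|A h XA gAh].
  apply: (sub_finite_set (B := `I_(h 0))) => [n /= nX|]; last exact: finite_II.
  rewrite ltnNge; apply/negP => hn; apply: nX.
  rewrite (_ : [set y | _] = f n (part h n)); first exact: fX.
  apply/predeqP => y /=; split=> [[|//]|]; last by right.
  by rewrite ltnNge hn.
move=> [n y] Any /=; have [nh|hn] := ltnP n (h 0); [by left|right].
apply: (gf n [set y | A (existT _ n y)]) => //.
  by apply: NP => //; apply: leq_trans hn; exact: (gAh 0).
by move=> k; have := gAh (pickle (n, k)).+1; rewrite /= pickleK.
Qed.

Lemma ideal_above_limit (X : nat -> setfam) :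
  (forall n, ideal_above (fun i j : nat => i <= j) (X n)) ->
  ideal_above dominated (limit_setfam X).
Proof.
move=> XP; have [N NP] := limit_members_eventually X.
pose g n := projT1 (cid (XP n)); pose f n := projT1 (cid (projT2 (cid (XP n)))).
have gX n i : members (g n i) by exact: (projT2 (cid (projT2 (cid (XP n))))).1.
have gf n : forall i A, members A -> g n i `<=` A -> i <= f n A.
  exact: (projT2 (cid (projT2 (cid (XP n))))).2.
pose runmax (h : nat -> nat) n := \max_(k < n.+1) h k.
exists (fun h => [set u : {n : nat & carrier (X n)} |
  g (tag u) (runmax h (tag u)) (tagged u)]).
(* At m the section of A is a member, and since n <= m the running maximum there takes [h n] into
   account. *)
exists (fun A n =>
  let m := maxn n (N A) in f m [set y | A (existT _ m y)]).
split => [h|h A XA ghA n].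
  apply: (sub_finite_set (B := set0)) => [n|]; last exact: finite_set0.
  by move=> nX; apply: nX; exact: (gX n (runmax h n)).
set m := maxn n (N A); apply: (@leq_trans (runmax h m)).
  have nm : n < m.+1 by rewrite ltnS leq_maxl.
  exact: (leq_bigmax (F := fun k : 'I_m.+1 => h k) (Ordinal nm)).
apply: gf; first by apply: NP => //; exact: leq_maxr.
by move=> y gy; exact: ghA.
Qed.

Lemma ideal_below_fin : ideal_below fin_setfam dominated.
Proof.
have [N NP] := finite_set_nat_bound.
(* A finite set is coded by a constant function; only [h 0] is read back. *)
exists (fun A _ => N A), (fun h => `I_(h 0)).
split=> [h|A h finA /(_ 0) NAh n An].
  exact: finite_II.
by apply: leq_trans NAh; exact: NP.
Qed.

Lemma ideal_above_fin : ideal_above (fun i j : nat => i <= j) fin_setfam.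
Proof.
have [N NP] := finite_set_nat_bound.
(* [I_i.+1] contains i itself, so the strict bound of any finite superset exceeds i. *)
exists (fun i => `I_i.+1), N; split=> [i|i A finA iA]; first exact: finite_II.
by apply: ltnW; apply: NP => //; apply: iA => /=.
Qed.

(** Constant functions embed omega in omega^omega, and evaluation at 0 reads the number back. *)
Lemma ideal_above_dominated_nat (X : setfam) :
  ideal_above dominated X -> ideal_above (fun i j : nat => i <= j) X.
Proof.
move=> [g [f [gX gf]]]; exists (fun i => g (fun=> i)), (fun A => f A 0).
by split=> // i A XA giA; exact: (gf _ A XA giA 0).
Qed.

Section FinPowerTukey.
Context {d : Order.disp_t} {W : orderType d}.
Variables (W_omega1 : is_omega1 W) (s : fundamental_system W).
Local Notation fin_power := (fin_power W_omega1 s).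

(** The junk value at 0 is [fin_setfam], so the first premise covers it too. *)
Lemma fin_power_ind (P : setfam -> Prop) :
  P fin_setfam -> (forall X, P X -> P (succ_setfam X)) ->
  (forall X, (forall n, P (X n)) -> P (limit_setfam X)) ->
  forall a, P (fin_power a).
Proof.
move=> Pfin Psucc Plim a.
elim/(well_founded_ind (omega1_wf W_omega1)): a => a IH.
rewrite fin_powerE /fin_power_step.
case: pselect => // _; case: pselect => [succ_a|_].
  by case: cid => b [ba _]; apply: Psucc; exact: IH.
case: pselect => // lim_a; apply: Plim => n.
exact: IH (fundamental_lt (fseqP s lim_a) n).
Qed.

Lemma fin_power_below a : ideal_below (fin_power a) dominated.
Proof.
apply: (fin_power_ind (fun X => ideal_below X _)).
- exact: ideal_below_fin.
- by move=> X XP; apply: ideal_below_succ; exact: ideal_below_limit.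
- exact: ideal_below_limit.
Qed.

(** The induction carries only omega, because fin is not above omega^omega; later stages reach
    omega^omega and are weakened again. *)
Lemma fin_power_above_nat a :
  ideal_above (fun i j : nat => i <= j) (fin_power a).
Proof.
apply: (fin_power_ind (ideal_above _)).
- exact: ideal_above_fin.
- move=> X XP; apply: ideal_above_dominated_nat.
  by apply: ideal_above_succ; exact: ideal_above_limit.
- by move=> X XP; apply: ideal_above_dominated_nat; exact: ideal_above_limit.
Qed.

(** As a > 1, the last stage is a limit or the successor of a nonzero ordinal; its sections are
    above omega, and the stage lifts this to omega^omega. *)
Lemma fin_power_above a : (exists2 o : W, is_one o & (o < a)%O) ->
  ideal_above dominated (fin_power a).
Proof.
move=> [o [z z0 [zo oS]] oa].
have [[b ba]|Nsucc] := pselect (exists b, is_succ b a).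
  have b0 : ~ is_zero b.
    (* A zero b would lie below o, which is 1, whence a <= o. *)
    by move=> b0; have := ba.2 o (Order.POrderTheory.le_lt_trans (b0 z) zo);
      rewrite Order.TotalTheory.leNgt oa.
  rewrite (fin_power_succ W_omega1 s b0 ba).
  apply: ideal_above_succ; apply: ideal_above_limit => _.
  exact: fin_power_above_nat.
have lim_a : is_limit a.
  by split=> // /(_ o); rewrite Order.TotalTheory.leNgt oa.
rewrite fin_power_limit //; apply: ideal_above_limit => n.
exact: fin_power_above_nat.
Qed.

End FinPowerTukey.

Theorem theorem3p3 (d : Order.disp_t) (W : orderType d)
  (W_omega1 : is_omega1 W) (s : fundamental_system W) (a : W)
  (a_gt1 : exists2 o : W, is_one o & (o < a)%O) :
  tukey_equiv (@members_le (fin_power W_omega1 s a)) dominated.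
Proof.
split; first exact: ideal_below_tukey_le (fin_power_below W_omega1 s a).
exact: ideal_above_tukey_le (fin_power_above W_omega1 s a a_gt1).
Qed.
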